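(* For every positive integer $n$, $$\sum_{\sigma\in B_n}\prod_{i=1}^n q_i^{d_i(\sigma)+n_i(\sigma^{-1})}=\sum_{\sigma\in B_n}\prod_{i=1}^n q_i^{2d_i(\sigma)+\varepsilon_i(\sigma)}.$$
   Context: $B_n$ is the group of signed permutations (bijections $\sigma$ of $[-n,n]\setminus\{0\}$ with $\sigma(-a)=-\sigma(a)$). For $\sigma\in B_n$: ${\it Des}(\sigma)=\{i\in[n-1]:\sigma(i)>\sigma(i+1)\}$ (usual order on integers); $d_i(\sigma)=|\{j\in{\it Des}(\sigma):j\ge i\}|$; ${\it Neg}(\sigma)=\{i\in[n]:\sigma(i)<0\}$; $n_i(\sigma)=|\{j\in{\it Neg}(\sigma):j\ge i\}|$; $\varepsilon_i(\sigma)=1$ if $\sigma(i)<0$, else $0$. *)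

(* Defs.v *)
From HB Require Import structures.
From mathcomp Require Import all_boot all_order all_algebra all_fingroup.
Set Implicit Arguments.
Unset Strict Implicit.
Unset Printing Implicit Defensive.
Import Order.TTheory GRing.Theory Num.Theory.
Local Open Scope ring_scope.

(* The set [-n, n] \ {0}: the pair (b, i) stands for the integer
   (-1) ^ b * (i + 1), so that (false, i) is the (0-based) i-th positive
   element.  Lemmas [spoint_val_inj] and [spoint_valP] identify [spoint n] with
   the set of nonzero integers of absolute value at most n. *)
Definition spoint (n : nat) : finType := (bool * 'I_n)%type.

Definition spoint_val (n : nat) (a : spoint n) : int :=
  (-1) ^+ a.1 * (a.2.+1)%:Z.

Definition spoint_opp (n : nat) (a : spoint n) : spoint n := (~~ a.1, a.2).

Lemma spoint_val_inj (n : nat) : injective (@spoint_val n).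
Proof.
move=> [b i] [c j]; rewrite /spoint_val /= => E.
have Eij : i = j.
  apply/val_inj; have := congr1 absz E.
  by rewrite !abszMsign /= => -[].
rewrite -{}Eij in E *; congr (_, _).
by case: b E => [] //=; case: c => //=; rewrite !(mul1r, mulN1r).
Qed.

Lemma spoint_valP (n : nat) (x : int) :
  (exists a : spoint n, spoint_val a = x) <-> (x != 0 /\ `|x| <= n%:Z).
Proof.
split=> [[[b i] <-]|[x0 xn]].
  rewrite /spoint_val /= normrMsign; split; last by rewrite lez_nat ltn_ord.
  by rewrite mulf_neq0 // signr_eq0.
have lt_n : (`|x|.-1 < n)%N.
  by rewrite prednK ?absz_gt0 // -lez_nat abszE.
exists (x < 0, Ordinal lt_n).
by rewrite /spoint_val /= prednK ?absz_gt0 // abszE -numEsign.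
Qed.

Lemma spoint_val_opp (n : nat) (a : spoint n) :
  spoint_val (spoint_opp a) = - spoint_val a.
Proof. by rewrite /spoint_val /= signrN mulNr. Qed.

Definition signed_perms (n : nat) : {set {perm spoint n}} :=
  [set s : {perm spoint n} | [forall a, s (spoint_opp a) == spoint_opp (s a)]].

Lemma signed_perms_group_set (n : nat) : group_set (signed_perms n).
Proof.
apply/group_setP; split=> [|s t]; first by rewrite inE; apply/forallP=> a; rewrite !perm1.
rewrite !inE => /forallP Hs /forallP Ht; apply/forallP=> a.
by rewrite !permM (eqP (Hs a)) (eqP (Ht _)).
Qed.
Canonical signed_perms_group (n : nat) : {group {perm spoint n}} :=
  Group (signed_perms_group_set n).

(* Positions 1, ..., n are indexed by 'I_n, i : 'I_n being position i + 1;
   [window s i] is the integer that s takes there. *)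
Definition window (n : nat) (s : {perm spoint n}) (i : 'I_n) : int :=
  spoint_val (s (false, i)).

(* The existence of the successor position j excludes the last position. *)
Definition Des (n : nat) (s : {perm spoint n}) : {set 'I_n} :=
  [set i : 'I_n | [exists j : 'I_n,
     (j == i.+1 :> nat) && (window s j < window s i)]].

Definition Neg (n : nat) (s : {perm spoint n}) : {set 'I_n} :=
  [set i : 'I_n | window s i < 0].

Definition des_from (n : nat) (s : {perm spoint n}) (i : 'I_n) : nat :=
  #|[set j in Des s | (i <= j)%N]|.

Definition neg_from (n : nat) (s : {perm spoint n}) (i : 'I_n) : nat :=
  #|[set j in Neg s | (i <= j)%N]|.

Definition eps (n : nat) (s : {perm spoint n}) (i : 'I_n) : nat :=
  if window s i < 0 then 1%N else 0%N.

(* Main.v *)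
(* A signed permutation is a pair (O, p): p gives the absolute values of its
   window, and O is the set of absolute values of its negative entries.

   On the left, Neg (s^-1) = O, and for fixed O the order-preserving relabelling
   of the values by 0, ..., n - 1 turns the descents of s into those of an
   arbitrary p in 'S_n.  So the left-hand side is the sum over all pairs (N, p)
   of the monomials with exponents l_i = d_i(p) + #{j in N | i <= j}.

   On the right, send (N, p) to the signed permutation s that is negative at
   the positions where l_i is odd and that is obtained from p by reversing the
   order of the values at these positions, so that their signed values compare
   as in p.  Then l_i - l_(i+1) = [i in Des p] + [i in N] is 1 if s changes
   sign between i and i + 1, and 2 [i in Des s] otherwise, whence
   l_i = 2 d_i(s) + eps_i(s).  The map is injective, because the parities of
   the l_i and p determine N. *)
Require Import Defs.
From HB Require Import structures.
From mathcomp Require Import all_boot all_order all_algebra all_fingroup.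
From mathcomp Require Import zify.
Set Implicit Arguments.
Unset Strict Implicit.
Unset Printing Implicit Defensive.
Import Order.TTheory GRing.Theory Num.Theory.
Local Open Scope ring_scope.

(** * Counting the elements of a set from a position on *)

Definition count_from (n : nat) (S : {set 'I_n}) (i : nat) : nat :=
  #|[set j in S | (i <= j)%N]|.

(** [count_from] takes a natural number so that position [n], where the count vanishes, can start
    downward recursions. *)
Lemma count_from_ge (n : nat) (S : {set 'I_n}) (i : nat) :
  (n <= i)%N -> count_from S i = 0%N.
Proof.
move=> le_ni; apply/eqP; rewrite cards_eq0; apply/eqP/setP=> j; rewrite !inE.
by apply/negbTE; rewrite negb_and -ltnNge (leq_trans (ltn_ord j) le_ni) orbT.
Qed.

Lemma count_fromS (n : nat) (S : {set 'I_n}) (i : 'I_n) :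
  count_from S i = ((i \in S) + count_from S i.+1)%N.
Proof.
rewrite /count_from (cardsD1 i) inE leqnn andbT; congr (_ + _)%N.
apply: eq_card => j; rewrite !inE [(i < j)%N]ltn_neqAle -val_eqE /= eq_sym.
by rewrite andbCA.
Qed.

(** Membership of [i] is the parity of the difference of the counts at [i] and [i.+1]. *)
Lemma odd_count_from_inj (n : nat) (S T : {set 'I_n}) :
  (forall i : 'I_n, odd (count_from S i) = odd (count_from T i)) -> S = T.
Proof.
move=> ST; have {}ST i : odd (count_from S i) = odd (count_from T i).
  have [le_ni | lt_in] := leqP n i; first by rewrite !count_from_ge.
  exact: (ST (Ordinal lt_in)).
apply/setP=> i; have := ST i; rewrite !count_fromS !oddD ST !oddb.
by move/addIb.
Qed.

(** * Relabelling and reversing values *)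

(** Take [r a] to be the number of keys below [k a]. With signed values as keys, this is the
    relabelling used on the left-hand side. *)
Lemma rank_perm (n : nat) d (T : orderType d) (k : 'I_n -> T) :
  injective k ->
  exists r : {perm 'I_n}, forall a b, (r a < r b)%N = (k a < k b)%O.
Proof.
move=> k_inj; pose below a := [set c | (k c < k a)%O].
have below_proper a b : (k a < k b)%O -> (#|below a| < #|below b|)%N.
  move=> lt_ab; apply/proper_card/properP; split.
    by apply/subsetP=> c; rewrite !inE => /lt_trans; apply.
  by exists a; rewrite !inE ?ltxx.
have rank_lt a : (#|below a| < n)%N.
  rewrite -[X in (_ < X)%N]card_ord -cardsT; apply/proper_card/properP; split.
    exact: subsetT.
  by exists a; rewrite !inE ?ltxx.
pose rank a := Ordinal (rank_lt a).
have rankE a b : (rank a < rank b)%N = (k a < k b)%O.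
  case: (ltgtP (k a) (k b)) => [/below_proper //|/below_proper|/k_inj ->] /=.
    by move=> lt_ba; apply/negbTE; rewrite -leqNgt ltnW.
  by rewrite ltnn.
have rank_inj : injective rank.
  move=> a b eq_ab; apply: k_inj; apply/eqP.
  by rewrite eq_le !leNgt -!rankE eq_ab ltnn.
by exists (perm rank_inj) => a b; rewrite !permE.
Qed.

(** [enum O] is increasing, so this is the order-reversing involution of [O], extended by the
    identity. The default of [nth] is never reached. *)
Definition rev_on (n : nat) (O : {set 'I_n}) (a : 'I_n) : 'I_n :=
  if a \in O then nth a (rev (enum O)) (index a (enum O)) else a.

Lemma rev_on_in (n : nat) (O : {set 'I_n}) (a : 'I_n) :
  (rev_on O a \in O) = (a \in O).
Proof.
rewrite /rev_on; case: ifP => // aO.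
by rewrite -mem_enum -mem_rev mem_nth // size_rev index_mem mem_enum.
Qed.

Lemma index_rev_on (n : nat) (O : {set 'I_n}) (a : 'I_n) : a \in O ->
  index (rev_on O a) (enum O) = (size (enum O) - (index a (enum O)).+1)%N.
Proof.
move=> aO; have lt_a : (index a (enum O) < size (enum O))%N.
  by rewrite index_mem mem_enum.
by rewrite /rev_on aO nth_rev // index_uniq ?enum_uniq // ltn_subrL (leq_trans _ lt_a).
Qed.

Lemma rev_onK (n : nat) (O : {set 'I_n}) : involutive (rev_on O).
Proof.
move=> a; have [aO | aNO] := boolP (a \in O); last first.
  by rewrite /rev_on (negbTE aNO) (negbTE aNO).
have lt_a : (index a (enum O) < size (enum O))%N.
  by rewrite index_mem mem_enum.
have raO : rev_on O (rev_on O a) \in enum O by rewrite mem_enum !rev_on_in.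
rewrite -[LHS](nth_index a raO) !index_rev_on ?rev_on_in //.
by rewrite subnSK // subKn 1?ltnW // nth_index ?mem_enum.
Qed.

Lemma ltn_index_enum_ord (n : nat) (O : {set 'I_n}) (a b : 'I_n) :
  a \in O -> b \in O ->
  (index a (enum O) < index b (enum O))%N = (a < b)%N.
Proof.
move=> aO bO; have trT : transitive (fun x y : 'I_n => (x < y)%N).
  by move=> x y z; apply: ltn_trans.
have srt : sorted (fun x y : 'I_n => (x < y)%N) (enum O).
  rewrite /enum_mem; apply: sorted_filter => //.
  by rewrite -enumT -(@sorted_map _ _ val ltn) val_enum_ord iota_ltn_sorted.
have mono x y : x \in O -> y \in O ->
    (index x (enum O) < index y (enum O))%N -> (x < y)%N.
  move=> xO yO; apply: (sorted_ltn_index trT srt); by rewrite mem_enum.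
case: (ltngtP (index a (enum O)) (index b (enum O))) => [/mono-> //||].
  by move/mono=> /(_ bO aO) lt_ba; rewrite ltnNge ltnW.
move=> eq_ab; suff -> : a = b by rewrite ltnn.
by rewrite -(@nth_index _ a a (enum O)) ?eq_ab ?nth_index ?mem_enum.
Qed.

Lemma ltn_rev_on (n : nat) (O : {set 'I_n}) (a b : 'I_n) :
  a \in O -> b \in O -> (rev_on O a < rev_on O b)%N = (b < a)%N.
Proof.
move=> aO bO; rewrite -(ltn_index_enum_ord (O := O)) ?rev_on_in //.
rewrite !index_rev_on // -(ltn_index_enum_ord bO aO).
(* Both indices are below the size, so the truncated subtractions do reverse the order. *)
have := aO; have := bO; rewrite -(mem_enum O a) -(mem_enum O b) -!index_mem.
by move: (index a _) (index b _) (size _) => x y z; lia.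
Qed.

(** * Signed permutations as pairs [(O, p)] *)

Definition rev_on_perm (n : nat) (O : {set 'I_n}) : {perm 'I_n} :=
  perm (can_inj (@rev_onK n O)).

Definition signed_val (n : nat) (O : {set 'I_n}) (a : 'I_n) : int :=
  spoint_val (a \in O, a).

Lemma signed_val_inj (n : nat) (O : {set 'I_n}) : injective (signed_val O).
Proof. by move=> a b /spoint_val_inj []. Qed.

Lemma signed_val_lt0 (n : nat) (O : {set 'I_n}) (a : 'I_n) :
  (signed_val O a < 0) = (a \in O).
Proof. by rewrite /signed_val /spoint_val /=; case: (a \in O) => /=; lia. Qed.

Lemma signed_val_lt (n : nat) (O : {set 'I_n}) (a b : 'I_n) :
  (signed_val O a < signed_val O b) =
  if a \in O then (b \in O) ==> (b < a)%N else (b \notin O) && (a < b)%N.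
Proof.
by rewrite /signed_val /spoint_val /=; case: (a \in O); case: (b \in O) => /=; lia.
Qed.

Definition perm_Des (n : nat) (p : {perm 'I_n}) : {set 'I_n} :=
  [set i : 'I_n | [exists j : 'I_n, (j == i.+1 :> nat) && (p j < p i)%N]].

Section SignedPermOf.
Variables (n : nat) (O : {set 'I_n}) (p : {perm 'I_n}).

Definition signed_fun (x : spoint n) : spoint n :=
  (x.1 (+) (p x.2 \in O), p x.2).

Lemma signed_fun_inj : injective signed_fun.
Proof.
move=> [b i] [c j] [E /perm_inj Eij].
by move: E; rewrite /= Eij => /addIb ->.
Qed.

Definition signed_perm_of : {perm spoint n} := perm signed_fun_inj.

Lemma signed_perm_of_in : signed_perm_of \in signed_perms n.
Proof.
rewrite inE; apply/forallP=> -[b i]; rewrite !permE /signed_fun /spoint_opp /=.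
by rewrite addNb.
Qed.

Lemma window_signed_perm_of i : window signed_perm_of i = signed_val O (p i).
Proof. by rewrite /window permE. Qed.

Lemma eps_signed_perm_of i : eps signed_perm_of i = (p i \in O).
Proof. by rewrite /eps window_signed_perm_of signed_val_lt0; case: ifP. Qed.

Lemma Neg_signed_perm_ofV : Neg (signed_perm_of^-1)%g = O.
Proof.
apply/setP=> a; rewrite inE /window.
have -> : (signed_perm_of^-1)%g (false, a) = (a \in O, (p^-1)%g a).
  apply: (@perm_inj _ signed_perm_of); rewrite permKV permE /signed_fun /=.
  by rewrite permKV addbb.
by rewrite /spoint_val /=; case: (a \in O) => /=; lia.
Qed.

End SignedPermOf.

Lemma big_signed_perms (n : nat) (R : nmodType)
    (F : {perm spoint n} -> R) :
  \sum_(s in signed_perms n) F s =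
  \sum_(x : {set 'I_n} * {perm 'I_n}) F (signed_perm_of x.1 x.2).
Proof.
pose absf (s : {perm spoint n}) := [ffun i : 'I_n => (s (false, i)).2].
have sE s b i : s \in signed_perms n ->
    s (b, i) = (b (+) (s (false, i)).1, (s (false, i)).2).
  rewrite inE => /forallP /(_ (false, i)) /eqP sN; case: b => /=.
    by rewrite -[(true, i)]/(spoint_opp (false, i)) sN.
  by case: (s _).
have abs_inj s : s \in signed_perms n -> injective (absf s).
  move=> ss i j; rewrite !ffunE => Eij.
  (* Positions with equal absolute values have images equal up to sign, so injectivity of [s]
     identifies them. *)
  have : s (false, i) = s ((s (false, i)).1 (+) (s (false, j)).1, j).
    rewrite [RHS]sE // -Eij -addbA addbb addbF.
    by case: (s _).
  by move/perm_inj=> [].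
pose absp s : {perm 'I_n} := insubd (1%g : {perm 'I_n}) (absf s).
have abspE s i : s \in signed_perms n -> absp s i = (s (false, i)).2.
  move=> /abs_inj /injectiveP inj_s.
  by rewrite -pvalE -[pval _]/(val _) insubdK // ffunE.
pose g (s : {perm spoint n}) : {set 'I_n} * {perm 'I_n} :=
  (Neg (s^-1)%g, absp s).
rewrite (reindex (fun x => signed_perm_of x.1 x.2)) /=.
  by apply: eq_bigl => x; rewrite signed_perm_of_in.
exists g => [[O p]|s] /= ss.
  congr (_, _); first exact: Neg_signed_perm_ofV.
  by apply/permP=> i; rewrite abspE // permE.
apply/permP=> -[b i]; rewrite permE /signed_fun /= abspE // (sE s b) //.
congr (_ (+) _, _); rewrite inE /window.
have -> : (s^-1)%g (false, (s (false, i)).2) = ((s (false, i)).1, i).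
  by apply: (@perm_inj _ s); rewrite permKV [RHS]sE // addbb.
by rewrite /spoint_val /=; case: (s (false, i)).1 => /=; lia.
Qed.

Lemma mem_Des_signed_perm_of (n : nat) (O : {set 'I_n}) (p : {perm 'I_n})
    (i j : 'I_n) : j = i.+1 :> nat ->
  (i \in Des (signed_perm_of O p)) = (signed_val O (p j) < signed_val O (p i)).
Proof.
move=> Eij; rewrite inE; apply/existsP/idP=> [[k /andP[/eqP Ek]] | lt_ji].
  have -> : k = j by apply: ord_inj; rewrite Ek Eij.
  by rewrite !window_signed_perm_of.
by exists j; rewrite Eij eqxx !window_signed_perm_of.
Qed.

Lemma mem_perm_Des (n : nat) (p : {perm 'I_n}) (i j : 'I_n) :
  j = i.+1 :> nat -> (i \in perm_Des p) = (p j < p i)%N.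
Proof.
move=> Eij; rewrite inE; apply/existsP/idP=> [[k /andP[/eqP Ek]] | lt_ji].
  by have -> : k = j by apply: ord_inj; rewrite Ek Eij.
by exists j; rewrite Eij eqxx.
Qed.

(** * The bijection for the right-hand side *)

Section OddReversal.
Variable n : nat.
Implicit Types (N : {set 'I_n}) (p : {perm 'I_n}).

Definition level N p (i : nat) : nat :=
  (count_from (perm_Des p) i + count_from N i)%N.

(** Since [rev_on] preserves this set of values of [p], it also gives the negative positions after
    the reversal. *)
Definition odd_values N p : {set 'I_n} :=
  [set a | odd (level N p ((p^-1)%g a))].

Definition odd_reversal (x : {set 'I_n} * {perm 'I_n}) :=
  let O := odd_values x.1 x.2 in (O, (x.2 * rev_on_perm O)%g).

Lemma odd_values_perm N p (i : 'I_n) :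
  (p i \in odd_values N p) = odd (level N p i).
Proof. by rewrite inE permK. Qed.

Lemma odd_reversal_inj : injective odd_reversal.
Proof.
move=> [N p] [M r]; rewrite /odd_reversal /= => -[EO].
rewrite EO => /mulIg Ep; subst r; congr (_, _).
apply: odd_count_from_inj => i.
have := odd_values_perm M p i; rewrite -EO odd_values_perm /level !oddD.
by move/addbI.
Qed.

Lemma level_last N p (i : 'I_n) : i.+1 = n -> level N p i = (i \in N).
Proof.
move=> Ei; rewrite /level !count_fromS !(@count_from_ge _ _ i.+1) ?Ei //.
rewrite !addn0; suff /negbTE -> : i \notin perm_Des p by [].
rewrite inE; apply/existsP=> -[j /andP[/eqP Ej _]].
by have := ltn_ord j; rewrite Ej Ei ltnn.
Qed.

(** Downward induction on [i]. Levels of equal parity at [i] and [i.+1] differ by 0 or 2, the latter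
    at a descent. Otherwise they differ by 1, and the half grows exactly when the level at [i] is
    even: there [s] passes from positive to negative, a descent. *)
Lemma half_level N p (i : nat) :
  let x := odd_reversal (N, p) in
  count_from (Des (signed_perm_of x.1 x.2)) i = (level N p i)./2.
Proof.
rewrite /=; set O := odd_values N p; set s := signed_perm_of _ _.
have [k] := ubnP (n - i); elim: k i => // k IHk i lt_k.
have [le_ni | lt_in] := leqP n i.
  by rewrite /level !count_from_ge.
rewrite -[i]/(val (Ordinal lt_in)); set i' := Ordinal lt_in.
have [Ei | neq_i] := eqVneq i.+1 n.
  rewrite level_last // count_fromS count_from_ge /= ?Ei // addn0.
  have /negbTE -> : i' \notin Des s.
    rewrite inE; apply/existsP=> -[j /andP[/eqP Ej _]].
    by have := ltn_ord j; rewrite Ej /= Ei ltnn.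
  by case: (i' \in N).
have lt_i1 : (i.+1 < n)%N by rewrite ltn_neqAle neq_i.
pose j := Ordinal lt_i1; have Ej : j = i'.+1 :> nat by [].
have := odd_values_perm N p i'; have := odd_values_perm N p j.
have -> : level N p i' = ((i' \in perm_Des p) + (i' \in N) + level N p j)%N.
  by rewrite /level (count_fromS (perm_Des p) i') (count_fromS N i') addnACA.
rewrite count_fromS -[i'.+1]/(val j) IHk /=; last by lia.
rewrite (mem_Des_signed_perm_of _ _ Ej) (mem_perm_Des _ Ej) signed_val_lt.
rewrite !permM !permE !rev_on_in -/O.
have [iO|iO] := boolP (p i' \in O); have [jO|jO] := boolP (p j \in O) => /=.
(* Two negative entries: the reversal by [rev_on] cancels the one caused by the signs. *)
- by rewrite ltn_rev_on //; case: (_ < _)%N; case: (_ \in N) => /=; lia.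
- by case: (_ < _)%N; case: (_ \in N) => /=; lia.
- by case: (_ < _)%N; case: (_ \in N) => /=; lia.
rewrite /rev_on (negbTE iO) (negbTE jO).
by case: (_ < _)%N; case: (_ \in N) => /=; lia.
Qed.

End OddReversal.

Theorem theorem6p1 (n : nat) (hn : (0 < n)%N) (R : comNzRingType)
    (q : 'I_n -> R) :
  \sum_(s in signed_perms n)
     \prod_(i < n) q i ^+ (des_from s i + neg_from (s^-1)%g i) =
  \sum_(s in signed_perms n)
     \prod_(i < n) q i ^+ (2 * des_from s i + eps s i).
Proof.
transitivity (\sum_(x : {set 'I_n} * {perm 'I_n})
    \prod_(i < n) q i ^+ level x.1 x.2 i).
  rewrite big_signed_perms.
  rewrite -(pair_bigA _ (fun O p => \prod_(i < n) q i ^+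
      (des_from (signed_perm_of O p) i +
       neg_from (signed_perm_of O p)^-1%g i))).
  rewrite -(pair_bigA _ (fun N p => \prod_(i < n) q i ^+ level N p i)) /=.
  apply: eq_bigr => O _.
  have [r rE] := rank_perm (@signed_val_inj n O).
  (* For fixed [O], the signed values of [p] compare as the values of [p * r]. *)
  rewrite [RHS](reindex_inj (mulIg r)) /=; apply: eq_bigr => p _.
  apply: eq_bigr => i _; congr (_ ^+ _).
  rewrite /level /neg_from Neg_signed_perm_ofV; congr (_ + _)%N.
  apply: eq_card => j; rewrite !inE; congr (_ && _); apply: eq_existsb => k.
  by rewrite !window_signed_perm_of !permM rE.
(* An injective self-map of the finite set of pairs is a bijection. *)
rewrite big_signed_perms [RHS](reindex_inj (@odd_reversal_inj n)) /=.
apply: eq_bigr => -[N p] _; apply: eq_bigr => i _; congr (_ ^+ _).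
rewrite -[des_from _ i]/(count_from _ i) half_level.
rewrite eps_signed_perm_of permM permE rev_on_in odd_values_perm.
by rewrite mul2n addnC odd_double_half.
Qed.
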